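(* Let $\dot{\mathbf{x}} = \mathbf{f}(\mathbf{x})$ be an autonomous system on $\mathbb{R}^n$ with polynomial dynamics, i.e. every component of $\mathbf{f}:\mathbb{R}^n\to\mathbb{R}^n$ is a real polynomial in $\mathbf{x}=(x_1,\dots,x_n)$. Suppose there exists a symmetric polynomial matrix $\mathbf{M}(\mathbf{x})\in\mathbb{R}[\mathbf{x}]^{n\times n}$ such that $\mathbf{M}(\mathbf{x})$ is strictly SOS and $-\mathbf{R}(\mathbf{x})$ is strictly SOS, where $$\mathbf{R}(\mathbf{x}) = \frac{\partial \mathbf{f}}{\partial \mathbf{x}}^T \mathbf{M} + \mathbf{M}\frac{\partial \mathbf{f}}{\partial \mathbf{x}} + \dot{\mathbf{M}}, \qquad \dot{\mathbf{M}}(\mathbf{x}) = \sum_{i=1}^n \frac{\partial \mathbf{M}}{\partial x_i}(\mathbf{x})\, f_i(\mathbf{x}).$$ Then the system $\dot{\mathbf{x}} = \mathbf{f}(\mathbf{x})$ is globally contracting.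
   Context: A polynomial $p\in\mathbb{R}[\mathbf{x}]$ is a sum of squares (SOS) if $p=\sum_{i=1}^m q_i^2$ for some polynomials $q_1,\dots,q_m\in\mathbb{R}[\mathbf{x}]$. A symmetric matrix $\mathbf{S}(\mathbf{x})\in\mathbb{R}[\mathbf{x}]^{m\times m}$ is an SOS matrix if, for a vector $\mathbf{y}=[y_1,\dots,y_m]^T$ of new indeterminates, the scalar polynomial $\mathbf{y}^T\mathbf{S}(\mathbf{x})\mathbf{y}$ is a sum of squares in $\mathbb{R}[\mathbf{x},\mathbf{y}]$. The matrix $\mathbf{S}(\mathbf{x})$ is strictly SOS if $\mathbf{S}(\mathbf{x})-\epsilon\mathbf{I}$ is an SOS matrix for some constant $\epsilon>0$. Here $\frac{\partial \mathbf{f}}{\partial \mathbf{x}}$ is the Jacobian matrix of $\mathbf{f}$. A symmetric-matrix-valued function $\mathbf{M}$ is uniformly positive definite if there is $\epsilon>0$ with $\mathbf{M}\succeq\epsilon\mathbf{I}$ at all points, and uniformly negative definite if there is $\epsilon>0$ with $\mathbf{M}\preceq-\epsilon\mathbf{I}$ at all points. Given a system $\dot{\mathbf{x}}=\mathbf{f}(\mathbf{x},t)$ and a symmetric, continuously differentiable, uniformly positive definite matrix function (metric) $\mathbf{M}(\mathbf{x},t)$, a region of the state space is a contraction region with respect to $\mathbf{M}$ if $\frac{\partial \mathbf{f}}{\partial \mathbf{x}}^T \mathbf{M} + \mathbf{M}\frac{\partial \mathbf{f}}{\partial \mathbf{x}} + \dot{\mathbf{M}}$ is uniformly negative definite in that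 region, where $\dot{\mathbf{M}}=\sum_i \frac{\partial \mathbf{M}}{\partial x_i}f_i+\frac{\partial \mathbf{M}}{\partial t}$. The system is globally contracting if there is such a metric with respect to which the whole state space is a contraction region. *)

(* Defs.v *)
(* MathComp-Analysis, with multinomials for real polynomials in n variables.
   The notations of mpoly clash with those of MathComp-Analysis, hence the
   notation-free import; [mpoly n R] is the ring written {mpoly R[n]} there.

   Points of R^n are row vectors 'rV[R]_n, as for the library's [jacobian]. *)
From mathcomp Require Import all_boot all_order all_algebra.
From mathcomp Require Import all_classical all_reals all_analysis.
From mathcomp Require Import -(notations) mpoly.
Set Implicit Arguments.
Unset Strict Implicit.
Unset Printing Implicit Defensive.
Import Order.TTheory GRing.Theory Num.Theory.
Import numFieldNormedType.Exports.

Local Open Scope classical_set_scope.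
Local Open Scope ring_scope.

Section SumsOfSquares.
Variable R : realType.

Definition is_sos k (p : mpoly k R) : Prop :=
  exists s : seq (mpoly k R), p = \sum_(q <- s) q ^+ 2.

(* R[x,y] is [mpoly (n + m) R]: its first n variables are the x_i and its last
   m variables the y_j. *)
Definition embed_x n m : mpoly n R -> mpoly (n + m) R :=
  comp_mpoly [tuple mpolyX R (mnm1 (lshift m i)) | i < n].

Definition yvars n m : 'rV[mpoly (n + m) R]_m :=
  \row_(j < m) mpolyX R (mnm1 (rshift n j)).

Definition sos_form n m (S : 'M[mpoly n R]_m) : mpoly (n + m) R :=
  (yvars n m *m map_mx (@embed_x n m) S *m (yvars n m)^T) 0 0.

Definition is_sos_matrix n m (S : 'M[mpoly n R]_m) : Prop :=
  S^T = S /\ is_sos (sos_form S).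

Definition strictly_sos n m (S : 'M[mpoly n R]_m) : Prop :=
  exists2 eps : R, 0 < eps & is_sos_matrix (S - (mpolyC n eps)%:M).

End SumsOfSquares.

Section PolynomialSystems.
Variables (R : realType) (n : nat).

(* A polynomial vector field is given by the row F of its components. *)
Definition poly_field (F : 'rV[mpoly n R]_n) (x : 'rV[R]_n) : 'rV[R]_n :=
  map_mx (meval (x 0)) F.

Definition poly_jacobian (F : 'rV[mpoly n R]_n) : 'M[mpoly n R]_n :=
  \matrix_(i, j) mderiv j (F 0 i).

Definition poly_dot (F : 'rV[mpoly n R]_n) (M : 'M[mpoly n R]_n) :
    'M[mpoly n R]_n :=
  \sum_(i < n) F 0 i *: map_mx (mderiv i) M.

Definition poly_contraction_matrix (F : 'rV[mpoly n R]_n)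
    (M : 'M[mpoly n R]_n) : 'M[mpoly n R]_n :=
  (poly_jacobian F)^T *m M + M *m poly_jacobian F + poly_dot F M.

End PolynomialSystems.

Section Contraction.
Variables (R : realType) (n : nat).

Definition loewner_le (A B : 'M[R]_n) : Prop :=
  (B - A)^T = B - A /\ forall v : 'rV[R]_n, 0 <= (v *m (B - A) *m v^T) 0 0.

Definition uniformly_posdef T (D : set T) (A : T -> 'M[R]_n) : Prop :=
  exists2 eps : R, 0 < eps & forall z, D z -> loewner_le eps%:M (A z).

Definition uniformly_negdef T (D : set T) (A : T -> 'M[R]_n) : Prop :=
  exists2 eps : R, 0 < eps & forall z, D z -> loewner_le (A z) (- eps%:M).

Definition continuously_differentiable (U V : normedModType R) (g : U -> V) :
    Prop :=
  (forall z, differentiable g z) /\ (forall v, continuous (fun z => 'D_v g z)).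

Definition is_metric (M : 'rV[R]_n -> R -> 'M[R]_n) : Prop :=
  [/\ forall x t, (M x t)^T = M x t,
      continuously_differentiable (fun z : 'rV[R]_n * R => M z.1 z.2) &
      uniformly_posdef setT (fun z : 'rV[R]_n * R => M z.1 z.2)].

(* [jacobian] acts on row vectors from the right, so its (i, j) entry is the
   i-th partial derivative of the j-th component: it is transposed to get the
   usual Jacobian matrix. *)
Definition state_jacobian (f : 'rV[R]_n -> R -> 'rV[R]_n) (x : 'rV[R]_n)
    (t : R) : 'M[R]_n :=
  (jacobian (f^~ t) x)^T.

Definition metric_dot (f : 'rV[R]_n -> R -> 'rV[R]_n)
    (M : 'rV[R]_n -> R -> 'M[R]_n) (x : 'rV[R]_n) (t : R) : 'M[R]_n :=
  \sum_(i < n) f x t 0 i *: 'D_(delta_mx 0 i) (M^~ t) x + derive1 (M x) t.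

Definition contraction_matrix (f : 'rV[R]_n -> R -> 'rV[R]_n)
    (M : 'rV[R]_n -> R -> 'M[R]_n) (x : 'rV[R]_n) (t : R) : 'M[R]_n :=
  (state_jacobian f x t)^T *m M x t + M x t *m state_jacobian f x t
  + metric_dot f M x t.

(* Differentiability of f is required because [jacobian] is total, with a
   meaningless value where f is not differentiable. *)
Definition contraction_region (f : 'rV[R]_n -> R -> 'rV[R]_n)
    (M : 'rV[R]_n -> R -> 'M[R]_n) (C : set 'rV[R]_n) : Prop :=
  (forall x t, C x -> differentiable (f^~ t) x) /\
  uniformly_negdef (C `*` [set: R]) (fun z => contraction_matrix f M z.1 z.2).

Definition globally_contracting (f : 'rV[R]_n -> R -> 'rV[R]_n) : Prop :=
  exists2 M, is_metric M & contraction_region f M setT.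

End Contraction.

(* Main.v *)
(* Evaluating sums of squares at real points gives nonnegative numbers, so the
   two SOS certificates become uniform matrix inequalities.  Evaluation turns
   formal partial derivatives into directional derivatives, hence the polynomial
   contraction matrix evaluates to the contraction matrix of the
   time-independent metric given by M. *)
Require Import Defs.
From mathcomp Require Import all_boot all_order all_algebra.
From mathcomp Require Import all_classical all_reals all_analysis.
From mathcomp Require Import -(notations) mpoly.
Import Order.TTheory GRing.Theory Num.Theory.
Import numFieldNormedType.Exports.
Local Open Scope ring_scope.

(** Constants and variables generate the polynomial ring. This form of induction matches the sum and
    product rules of differentiation, whereas [mpolyind] adds one monomial term at a time. *)
Lemma mpoly_ring_ind (R : comNzRingType) n (P : mpoly n R -> Prop) :
  (forall c, P (mpolyC n c)) -> (forall i, P (mpolyX R (mnm1 i))) ->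
  (forall p q, P p -> P q -> P (p + q)) ->
  (forall p q, P p -> P q -> P (p * q)) -> forall p, P p.
Proof.
move=> PC PX PD PM; elim/mpolyind => [|c m p _ _ Pp].
  by rewrite -mpolyC0.
apply: (PD) => //; rewrite -mul_mpolyC; apply: (PM) => //.
(* A monomial is a product of powers of variables, so closure under products is enough. *)
rewrite mpolyXE_id; apply: big_ind => [|//|i _]; first by rewrite -mpolyC1.
elim: (fun_of_multinom m i) => [|k IHk]; first by rewrite expr0 -mpolyC1.
by rewrite exprS; apply: PM.
Qed.

Section Evaluation.
Context {R : realType} {n : nat}.

Lemma differentiable_meval (p : mpoly n R) (x : 'rV[R]_n) :
  differentiable (fun z : 'rV[R]_n => meval (z 0) p) x.
Proof.
elim/mpoly_ring_ind: p => [c|i|p q dp dq|p q dp dq].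
- under eq_fun do rewrite mevalC.
  exact: differentiable_cst.
- under eq_fun do rewrite mevalXU.
  exact: differentiable_coord.
- under eq_fun do rewrite mevalD.
  exact: differentiableD.
- under eq_fun do rewrite mevalM.
  exact: differentiableM.
Qed.

Lemma derive_coord (i : 'I_n) (x v : 'rV[R]_n) :
  'D_v (fun z : 'rV[R]_n => z 0 i) x = v 0 i.
Proof.
have dx : derivable (@id 'rV[R]_n) x v by exact: derivable_id.
by have := derive_mx dx; rewrite derive_id => /matrixP/(_ 0 i); rewrite mxE.
Qed.

(** Both sides are additive in [p] and obey the Leibniz rule, so they agree once they agree on
    constants and variables. *)
Lemma derive_meval (p : mpoly n R) (x v : 'rV[R]_n) :
  'D_v (fun z : 'rV[R]_n => meval (z 0) p) x =
  \sum_i v 0 i * meval (x 0) (mderiv i p).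
Proof.
have dble q : derivable (fun z : 'rV[R]_n => meval (z 0) q) x v.
  exact/diff_derivable/differentiable_meval.
elim/mpoly_ring_ind: p => [c|i|p q Dp Dq|p q Dp Dq].
- under eq_fun do rewrite mevalC.
  rewrite derive_cst big1// => i _.
  by rewrite mderivC meval0 mulr0.
- under eq_fun do rewrite mevalXU.
  rewrite derive_coord (bigD1 i)//= big1 ?addr0 => [|j ji].
    (* The remaining exponent is a unit exponent minus itself; writing the first as 0 plus itself
       lets [addmK] cancel it, leaving the monomial 1. *)
    by rewrite mderivX mnm1E eqxx scale1r
      -[X in mpolyX _ (mnm_sub X _)]add0m addmK mpolyX0 meval1 mulr1.
  by rewrite mderivX mnm1E eq_sym (negPf ji) scale0r meval0 mulr0.
- under eq_fun do rewrite mevalD.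
  rewrite (deriveD (dble p) (dble q)) Dp Dq -big_split/=.
  by apply: eq_bigr => i _; rewrite mderivD mevalD mulrDr.
- under eq_fun do rewrite mevalM.
  rewrite (deriveM (dble p) (dble q)) Dp Dq /GRing.scale/=.
  rewrite !mulr_sumr -big_split/=.
  apply: eq_bigr => i _.
  by rewrite mderivM mevalD !mevalM mulrDr addrC !mulrA [meval _ q * _]mulrC
    [meval _ p * _]mulrC; congr (_ + _); rewrite mulrAC.
Qed.

(** A matrix function is a finite sum of its scalar entries times constant basis matrices. *)
Lemma differentiable_mx {V : normedModType R} {k l}
    (f : V -> 'M[R]_(k, l)) (x : V) :
  (forall i j, differentiable (fun z => f z i j) x) -> differentiable f x.
Proof.
move=> df.
have -> : f = \sum_i \sum_j (fun z => f z i j *: delta_mx i j).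
  apply/funext => z; rewrite fct_sumE [LHS]matrix_sum_delta.
  by apply: eq_bigr => i _; rewrite fct_sumE.
apply: differentiable_sum => i; apply: differentiable_sum => j.
exact: differentiableZl.
Qed.

(** The shape is arbitrary so that vector fields are covered too: [poly_field F] is convertible to
    [eval_mx F]. *)
Definition eval_mx {k l} (A : 'M[mpoly n R]_(k, l)) (x : 'rV[R]_n) :
  'M[R]_(k, l) := map_mx (meval (x 0)) A.

Lemma differentiable_eval_mx {k l} (A : 'M[mpoly n R]_(k, l)) x :
  differentiable (eval_mx A) x.
Proof.
apply: differentiable_mx => i j; under eq_fun do rewrite mxE.
exact: differentiable_meval.
Qed.

Lemma derive_eval_mx {k l} (A : 'M[mpoly n R]_(k, l)) x v :
  'D_v (eval_mx A) x = \sum_i v 0 i *: eval_mx (map_mx (mderiv i) A) x.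
Proof.
rewrite derive_mx; last exact/diff_derivable/differentiable_eval_mx.
apply/matrixP => i j; rewrite mxE summxE.
under eq_fun do rewrite mxE.
by rewrite derive_meval; apply: eq_bigr => h _; rewrite !mxE.
Qed.

Lemma derive_eval_mx_delta {k l} (A : 'M[mpoly n R]_(k, l)) x i :
  'D_(delta_mx 0 i) (eval_mx A) x = eval_mx (map_mx (mderiv i) A) x.
Proof.
rewrite derive_eval_mx (bigD1 i)//= big1 ?addr0 => [|j ji].
  by rewrite mxE !eqxx scale1r.
by rewrite mxE (negPf ji) andbF scale0r.
Qed.

Lemma eval_mxD {k l} (A B : 'M[mpoly n R]_(k, l)) x :
  eval_mx (A + B) x = eval_mx A x + eval_mx B x.
Proof. exact: map_mxD. Qed.

Lemma eval_mxN {k l} (A : 'M[mpoly n R]_(k, l)) x :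
  eval_mx (- A) x = - eval_mx A x.
Proof. exact: map_mxN. Qed.

Lemma eval_mxM {k l m} (A : 'M[mpoly n R]_(k, l)) (B : 'M[mpoly n R]_(l, m)) x :
  eval_mx (A *m B) x = eval_mx A x *m eval_mx B x.
Proof. exact: map_mxM. Qed.

Lemma eval_mx_scalar {m} (c : R) x :
  eval_mx ((mpolyC n c)%:M : 'M[mpoly n R]_m) x = c%:M.
Proof. by rewrite /eval_mx map_scalar_mx/= mevalC. Qed.

Lemma is_sos_meval_ge0 {k} (p : mpoly k R) (z : 'I_k -> R) :
  is_sos p -> 0 <= meval z p.
Proof.
move=> [s ->]; rewrite raddf_sum/= sumr_ge0// => q _.
by rewrite rmorphXn sqr_ge0.
Qed.

Lemma meval_embed_x {m} (p : mpoly n R) (x : 'rV[R]_n) (y : 'rV[R]_m) :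
  meval (row_mx x y 0) (embed_x m p) = meval (x 0) p.
Proof.
rewrite /embed_x comp_mpoly_meval; apply: meval_eq => i.
by rewrite tnth_mktuple mevalXU row_mxEl.
Qed.

(** Evaluation at the concatenated point is a ring morphism, so it passes through the matrix
    products, sending the last [m] variables to [y] and the embedded entries of [S] to their values
    at [x]. *)
Lemma meval_sos_form {m} (S : 'M[mpoly n R]_m) (x : 'rV[R]_n) (y : 'rV[R]_m) :
  meval (row_mx x y 0) (sos_form S) = (y *m eval_mx S x *m y^T) 0 0.
Proof.
pose ev := meval (row_mx x y 0).
have evy : map_mx ev (yvars R n m) = y.
  by apply/rowP => j; rewrite !mxE /ev mevalXU row_mxEr.
have evS : map_mx ev (map_mx (embed_x m) S) = eval_mx S x.
  by apply/matrixP => i j; rewrite !mxE /ev meval_embed_x.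
transitivity (map_mx ev
    (yvars R n m *m map_mx (embed_x m) S *m (yvars R n m)^T) 0 0).
  by rewrite [RHS]mxE.
by rewrite !map_mxM -map_trmx evy evS.
Qed.

Lemma is_sos_matrix_eval {m} (S : 'M[mpoly n R]_m) (x : 'rV[R]_n) :
  is_sos_matrix S -> (eval_mx S x)^T = eval_mx S x /\
    forall v : 'rV[R]_m, 0 <= (v *m eval_mx S x *m v^T) 0 0.
Proof.
move=> [symS sosS]; split=> [|v]; first by rewrite map_trmx symS.
by rewrite -meval_sos_form is_sos_meval_ge0.
Qed.

(** The SOS margin [eps] is independent of the point, which gives uniformity. The map [x] allows
    index sets larger than the state space, such as pairs of state and time. *)
Lemma strictly_sos_posdef {T m} (S : 'M[mpoly n R]_m) (D : set T)
    (x : T -> 'rV[R]_n) :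
  strictly_sos S -> uniformly_posdef D (fun z => eval_mx S (x z)).
Proof.
move=> [eps eps0 sosS]; exists eps => // z _.
have := is_sos_matrix_eval _ (x z) sosS.
by rewrite eval_mxD eval_mxN eval_mx_scalar.
Qed.

Lemma strictly_sos_negdef {T m} (S : 'M[mpoly n R]_m) (D : set T)
    (x : T -> 'rV[R]_n) :
  strictly_sos (- S) -> uniformly_negdef D (fun z => eval_mx S (x z)).
Proof.
move=> [eps eps0 sosS]; exists eps => // z _.
have := is_sos_matrix_eval _ (x z) sosS.
(* Commuting the sum turns [- S - eps] into [- eps - S], the difference that [loewner_le] tests. *)
by rewrite addrC eval_mxD !eval_mxN eval_mx_scalar.
Qed.

Lemma jacobian_poly_field (F : 'rV[mpoly n R]_n) (x : 'rV[R]_n) :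
  (jacobian (poly_field F) x)^T = eval_mx (poly_jacobian F) x.
Proof.
have dF : differentiable (poly_field F) x by exact: differentiable_eval_mx.
(* Entries of [jacobian] are components of the differential at basis vectors, that is, of
   directional derivatives. *)
apply/matrixP => i j; rewrite !mxE -deriveE//.
by rewrite -[poly_field F]/(eval_mx F) derive_eval_mx_delta !mxE.
Qed.

Lemma contraction_matrix_eval (F : 'rV[mpoly n R]_n) (M : 'M[mpoly n R]_n) x t :
  contraction_matrix (fun x _ => poly_field F x) (fun x _ => eval_mx M x) x t =
  eval_mx (poly_contraction_matrix F M) x.
Proof.
rewrite /contraction_matrix /state_jacobian jacobian_poly_field.
rewrite /poly_contraction_matrix !eval_mxD !eval_mxM /eval_mx -map_trmx.
congr (_ + _).
rewrite /metric_dot derive1_cst addr0 /poly_dot.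
rewrite raddf_sum/=; apply: eq_bigr => i _.
by rewrite derive_eval_mx_delta /poly_field map_mxZ mxE.
Qed.

Lemma eval_mx_is_metric (M : 'M[mpoly n R]_n) :
  M^T = M -> strictly_sos M -> is_metric (fun x _ => eval_mx M x).
Proof.
move=> symM sosM; split=> [x t||]; first by rewrite map_trmx symM.
- have dfst k l (A : 'M[mpoly n R]_(k, l)) (z : 'rV[R]_n * R) :
      differentiable (fun z : 'rV[R]_n * R => eval_mx A z.1) z.
    apply: (@differentiable_comp _ _ _ _ fst (eval_mx A)).
      by apply: linear_differentiable => ?; exact: cvg_fst.
    exact: differentiable_eval_mx.
  split=> [z|v]; first exact: dfst.
  (* The derivative along [v] involves only [v.1] and is a combination of evaluated polynomial
     matrices, hence continuous. *)
  have -> : (fun z : 'rV[R]_n * R =>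
      'D_v (fun z : 'rV[R]_n * R => eval_mx M z.1) z) =
      \sum_i (fun z : 'rV[R]_n * R =>
        v.1 0 i *: eval_mx (map_mx (mderiv i) M) z.1).
    (* The difference quotients along [v] and along [v.1] are convertible, since the metric ignores
       time. *)
    by apply/funext => z; rewrite fct_sumE -derive_eval_mx.
  move=> z; apply: differentiable_continuous.
  by apply: differentiable_sum => i; exact/differentiableZ.
- exact: strictly_sos_posdef.
Qed.

End Evaluation.

Theorem lemma1 (R : realType) (n : nat) (F : 'rV[mpoly n R]_n) :
  (exists M : 'M[mpoly n R]_n,
     [/\ M^T = M,
         strictly_sos M &
         strictly_sos (- poly_contraction_matrix F M)]) ->
  globally_contracting (fun x _ => poly_field F x).
Proof.
move=> [M [symM sosM sosR]].
exists (fun x _ => eval_mx M x); first exact: eval_mx_is_metric.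
split=> [x t _|]; first exact: differentiable_eval_mx.
under eq_fun do rewrite contraction_matrix_eval.
exact: strictly_sos_negdef.
Qed.
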